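(* There is a constant $n_0>0$ such that the following holds for all $n\geq n_0$ and all $p=p(n)$ with $0<p\leq 0.99$. Let $m$ be a median of $\vartheta(G(n,p))$, i.e. $\Pr(\vartheta(G(n,p))\leq m)\geq 1/2$ and $\Pr(\vartheta(G(n,p))\geq m)\geq 1/2$. (i) For every $\xi\geq\max\{10,m^{1/2}\}$: $\Pr(\vartheta(G(n,p))\geq m+\xi)\leq 30\exp(-\xi^2/(5m+10\xi))$. (ii) For every $\xi>10$: $\Pr(\vartheta(G(n,p))\leq m-\xi)\leq 3\exp(-\xi^2/(10m))$. The same statements hold with $\vartheta$ replaced by $\vartheta_{1/2}$ (with $m$ then a median of $\vartheta_{1/2}(G(n,p))$) or by $\vartheta_2$ (with $m$ a median of $\vartheta_2(G(n,p))$).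
   Context: $G(n,p)$ is the random graph on vertex set $V=\{1,\dots,n\}$ in which each of the $\binom n2$ possible edges is present independently with probability $p$. For a graph $G=(V,E)$ with $V=\{1,\dots,n\}$ and a real $k>1$, an $n$-tuple $(v_1,\dots,v_n)$ of unit vectors in $\mathbb R^n$ is a vector $k$-coloring if $\langle v_i,v_j\rangle\leq -1/(k-1)$ for all $\{i,j\}\in E$; it is strict if $\langle v_i,v_j\rangle=-1/(k-1)$ for all $\{i,j\}\in E$; it is rigid if $\langle v_i,v_j\rangle=-1/(k-1)$ for all $\{i,j\}\in E$ and $\langle v_i,v_j\rangle\geq -1/(k-1)$ for all $\{i,j\}\notin E$ ($i\neq j$). Let $\bar\vartheta_{1/2}(G)$, $\bar\vartheta(G)$, $\bar\vartheta_2(G)$ be the infimum of $k>1$ such that $G$ admits a vector, strict vector, resp. rigid vector $k$-coloring. For the complement $\bar G$ of $G$ set $\vartheta_{1/2}(G)=\bar\vartheta_{1/2}(\bar G)$, $\vartheta(G)=\bar\vartheta(\bar G)$ (the Lovász number), $\vartheta_2(G)=\bar\vartheta_2(\bar G)$. *)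

(* Defs.v *)
From HB Require Import structures.
From mathcomp Require Import all_boot all_order all_algebra.
From mathcomp Require Import all_classical all_reals.
From mathcomp Require Import all_analysis Rstruct.
Set Implicit Arguments. Unset Strict Implicit. Unset Printing Implicit Defensive.
Import Order.TTheory GRing.Theory Num.Theory.
Local Open Scope ring_scope.

Notation R := Rdefinitions.R.

(* A graph on V = 'I_n is an edge set E of ordered pairs (i,j) with i < j,
   i.e. E \in powerset (upper_pairs n). *)
Definition upper_pairs (n : nat) : {set 'I_n * 'I_n} :=
  [set ij : 'I_n * 'I_n | (val ij.1 < val ij.2)%N].

Definition adj n (E : {set 'I_n * 'I_n}) (i j : 'I_n) : bool :=
  ((i, j) \in E) || ((j, i) \in E).

Definition co_adj n (E : {set 'I_n * 'I_n}) (i j : 'I_n) : bool :=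
  (i != j) && ~~ adj E i j.

Definition dotv n (u w : 'rV[R]_n) : R := \sum_(l < n) u 0 l * w 0 l.

Inductive vkind := VecCol | StrictCol | RigidCol.

Definition is_coloring (kd : vkind) n (e : rel 'I_n) (k : R)
    (v : 'I_n -> 'rV[R]_n) : Prop :=
  (forall i, dotv (v i) (v i) = 1) /\
  match kd with
  | VecCol => forall i j, e i j -> dotv (v i) (v j) <= - (k - 1)^-1
  | StrictCol => forall i j, e i j -> dotv (v i) (v j) = - (k - 1)^-1
  | RigidCol => (forall i j, e i j -> dotv (v i) (v j) = - (k - 1)^-1) /\
                (forall i j, i != j -> ~~ e i j ->
                      dotv (v i) (v j) >= - (k - 1)^-1)
  end.

Definition bartheta (kd : vkind) n (e : rel 'I_n) : R :=
  inf [set k : R | 1 < k /\ exists v, is_coloring kd e k v].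

Definition theta (kd : vkind) n (E : {set 'I_n * 'I_n}) : R :=
  bartheta kd (co_adj E).

Definition Pr_Gnp (n : nat) (p : R) (P : {set 'I_n * 'I_n} -> Prop) : R :=
  \sum_(E in powerset (upper_pairs n))
     p ^+ #|E| * (1 - p) ^+ (#|upper_pairs n| - #|E|)%N
     * (if `[< P E >] then 1 else 0).

(* Main.v *)
Require Import Defs.
From HB Require Import structures.
From mathcomp Require Import all_boot all_order all_algebra.
From mathcomp Require Import all_classical all_reals.
From mathcomp Require Import all_analysis Rstruct.
From mathcomp Require Import zify ring lra.
From mathcomp Require Import fintype finset.
Import Order.TTheory GRing.Theory Num.Theory.
Local Open Scope ring_scope.
Set Implicit Arguments. Unset Strict Implicit. Unset Printing Implicit Defensive.

(* Talagrand's convex distance inequality is applied to the vertex exposure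
   product space. For each of the three parameters, a graph G has a certificate
   b with 0 <= b_i <= 1 and \sum_i b_i = theta(G), such that any graph G' that
   agrees with G on a vertex set S satisfies theta(G') >= \sum_(i in S) b_i. The
   unit vector proportional to b then shows that G has convex distance at least
   (theta(G) - a) / sqrt(theta(G)) from {theta <= a}, because
   \sum_i b_i^2 <= theta(G). Hence
     Pr(theta <= a) Pr(theta >= c) <= exp(- (c - a)^2 / (5 c)),
   and both tails follow by taking one of a, c to be the median.
   The certificate is a subgradient at 1 of a vertex-weighted theta function,
   which is sublinear in the weights; this replaces SDP strong duality. The
   constant 1/5 instead of Talagrand's 1/4 is enough and makes the elementary
   exponential estimate easy to prove. *)

(** * Elementary estimates for the exponential function *)

Lemma expR_ge_quadratic (K : realType) (x : K) :
  0 <= x -> 1 + x + x ^+ 2 / 2 <= expR x.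
Proof.
move=> x0; rewrite /expR.
have -> : 1 + x + x ^+ 2 / 2 = series (exp_coeff x) 3%N.
  rewrite /series /= !big_nat_recr //= big_nil /exp_coeff /=.
  by rewrite !factS fact0 !expr0 !muln1 divr1 add0r expr1 divr1.
apply: nondecreasing_cvgn_le; last exact: is_cvg_series_exp_coeff.
apply: nondecreasing_series => n _ _; exact: exp_coeff_ge0.
Qed.

Lemma expRN_le_quadratic (K : realType) (u : K) :
  0 <= u -> expR (- u) <= 1 - u + u ^+ 2 / 2.
Proof.
move=> u0; rewrite expRN.
have h := expR_ge_quadratic u0.
rewrite -[_^-1]mul1r ler_pdivrMr ?expR_gt0 //.
(* This product equals [1 + u ^+ 4 / 4]. *)
apply: (@le_trans _ _ ((1 - u + u ^+ 2 / 2) * (1 + u + u ^+ 2 / 2))); first nra.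
by apply: ler_wpM2l => //; nra.
Qed.

(** Square and invert the tangent bound [1 - v / 2 <= expR (- v / 2)]. *)
Lemma expR_le_invsq (K : realType) (v : K) :
  v < 2 -> expR v <= (1 - v / 2) ^- 2.
Proof.
move=> v2; have a0 : 0 < 1 - v / 2 by lra.
rewrite -[v in expR v]opprK expRN lef_pV2 ?posrE ?exprn_gt0 ?expR_gt0 //.
have -> : - v = - v / 2 + - v / 2 by lra.
rewrite exp.expRD expr2; have h := expR_ge1Dx (- v / 2).
by apply: ler_pM; lra.
Qed.

(* [lam = 1 + 5/2 * ln r] minimises the exponent; for [r < exp (-2/5)] it is
   negative and [lam = 0] is good enough. *)
Lemma talagrand_exponent (K : realType) (r : K) : 0 < r -> r <= 1 ->
  exists2 lam, 0 <= lam <= 1 &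
    expR ((1 - lam) ^+ 2 / 5 - lam * ln r) <= 2 - r.
Proof.
move=> r0 r1; have [u ur] : exists u, r = expR (- u).
  by exists (- ln r); rewrite opprK lnK.
have u0 : 0 <= u by move: r1; rewrite ur -exp.expR0 ler_expR; lra.
have [u25|u25] := leP u (2 / 5).
  exists (1 - 5 / 2 * u); first by apply/andP; split; lra.
  rewrite ur expRK.
  have -> : (1 - (1 - 5 / 2 * u)) ^+ 2 / 5 - (1 - 5 / 2 * u) * - u =
    u - 5 / 4 * u ^+ 2 by field.
  set v := u - _; have v2 : v < 2 by rewrite /v; nra.
  have h1 := expR_le_invsq v2; have h2 := expRN_le_quadratic u0.
  (* By [h2], [2 - r >= 1 + u - u ^+ 2 / 2], so a polynomial inequality remains. Once the
     denominator is cleared, the sides differ by [u ^+ 3] times a cubic that is positive on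
     [0, 2/5]. *)
  suff h3 : (1 - v / 2) ^- 2 <= 1 + u - u ^+ 2 / 2 by lra.
  have a0 : 0 < 1 - v / 2 by rewrite /v; nra.
  rewrite -[_^-1]mul1r ler_pdivrMr ?exprn_gt0 // /v.
  have -> : (1 + u - u ^+ 2 / 2) * (1 - (u - 5 / 4 * u ^+ 2) / 2) ^+ 2 =
    1 + u ^+ 3 * (11 / 8 - 63 / 64 * u + 45 / 64 * u ^+ 2 - 25 / 128 * u ^+ 3)
    by field.
  rewrite lerDl mulr_ge0 ?exprn_ge0 //.
  have : 0 <= u ^+ 2 * (45 / 64 - 25 / 128 * u) by rewrite mulr_ge0 ?sqr_ge0; lra.
  by rewrite [u ^+ 3]exprS; nra.
exists 0; first by rewrite lexx ler01.
rewrite mul0r !subr0 expr1n mul1r.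
(* [17 / 25] is the quadratic bound for [expR (- u)] at [u = 2 / 5]; the remaining room
   [2 - 17 / 25 = 33 / 25] exceeds the bound [100 / 81] for [expR 5^-1]. *)
have hr : r <= 17 / 25.
  have h2 := @expRN_le_quadratic _ (2 / 5 : K) ltac:(lra).
  have : r <= expR (- (2 / 5)) by rewrite ur ler_expR; lra.
  by rewrite expr2 in h2; lra.
have := @expR_le_invsq _ (5^-1 : K) ltac:(lra).
suff : (1 - 5^-1 / 2) ^- 2 <= 33 / 25 :> K by lra.
rewrite -[_^-1]mul1r ler_pdivrMr expr2; lra.
Qed.

(** * Bernoulli random subsets *)

Section BernoulliSubset.
Variables (K : realType) (T : finType) (p : K).
Implicit Types (D B E F : {set T}) (A : {set {set T}}).

Definition bern_weight D E : K := p ^+ #|E| * (1 - p) ^+ (#|D| - #|E|).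

Definition bern_mean D (f : {set T} -> K) : K :=
  \sum_(E in powerset D) bern_weight D E * f E.

Definition bern_pr D A : K := bern_mean D (fun E => (E \in A)%:R).

Lemma eq_bern_mean D f g :
  (forall E, E \subset D -> f E = g E) -> bern_mean D f = bern_mean D g.
Proof. by move=> fg; apply: eq_bigr => E; rewrite inE => /fg ->. Qed.

Lemma bern_meanD D f g :
  bern_mean D (fun E => f E + g E) = bern_mean D f + bern_mean D g.
Proof. by rewrite -big_split; apply: eq_bigr => E _; rewrite mulrDr. Qed.

Lemma bern_meanZ D c f : bern_mean D (fun E => c * f E) = c * bern_mean D f.
Proof. by rewrite /bern_mean big_distrr; apply: eq_bigr => E _; rewrite mulrCA. Qed.

Lemma powerset_setU D B (h : {set T} -> K) : [disjoint D & B] ->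
  \sum_(G in powerset (D :|: B)) h G =
  \sum_(F in powerset B) \sum_(E in powerset D) h (E :|: F).
Proof.
move=> DB; rewrite pair_big /=.
have part (X Y E F : {set T}) : [disjoint X & Y] -> E \subset X -> F \subset Y ->
    (E :|: F) :&: X = E.
  move=> XY /setIidPl EX FY; rewrite setIUl EX.
  by rewrite disjoint_setI0 ?setU0 // disjoint_sym (disjointWr FY).
have part1 E F ED FB := part _ _ E F DB ED FB.
have part2 E F : E \subset D -> F \subset B -> (E :|: F) :&: B = F.
  by move=> ED FB; rewrite setUC (part B D) // disjoint_sym.
rewrite (reindex_onto (fun FE : {set T} * {set T} => FE.2 :|: FE.1)
  (fun G => (G :&: B, G :&: D))) /=; last first.
  by move=> G; rewrite inE -setIUr => /setIidPl.
apply: eq_bigl => -[F E] /=; rewrite !inE. apply/idP/idP.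
  by case/andP=> _ /eqP[<- <-]; rewrite !subsetIr.
by case/andP=> FB ED; rewrite part1 // part2 // eqxx setUSS.
Qed.

Lemma bern_weightU D B E F : [disjoint D & B] -> E \subset D -> F \subset B ->
  bern_weight (D :|: B) (E :|: F) = bern_weight B F * bern_weight D E.
Proof.
move=> DB ED FB.
have EF : [disjoint E & F] by apply: disjointWl ED _; apply: disjointWr FB _.
rewrite /bern_weight !cardsU !disjoint_setI0 // !cards0 !subn0.
have -> : (#|D| + #|B| - (#|E| + #|F|) = (#|B| - #|F|) + (#|D| - #|E|))%N.
  by have := subset_leq_card ED; have := subset_leq_card FB; lia.
by rewrite !exprD; ring.
Qed.

(** Fubini's theorem: the traces of a Bernoulli subset on disjoint sets are independent. It permits
    conditioning on one block at a time. *)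
Lemma bern_meanU D B f : [disjoint D & B] ->
  bern_mean (D :|: B) f =
  bern_mean B (fun F => bern_mean D (fun E => f (E :|: F))).
Proof.
move=> DB; rewrite /bern_mean powerset_setU //.
apply: eq_bigr => F; rewrite inE => FB; rewrite big_distrr /=.
apply: eq_bigr => E; rewrite inE => ED.
by rewrite bern_weightU // mulrA.
Qed.

Lemma bern_mean1 D : bern_mean D (fun=> 1) = 1.
Proof.
elim: {D}#|D| {-2}D (erefl #|D|) => [|n IH] D cD.
  move/cards0_eq: cD => ->; rewrite /bern_mean powerset0 big_set1.
  by rewrite /bern_weight cards0 !expr0 !mulr1.
have [x xD] : exists x, x \in D by apply/card_gt0P; rewrite cD.
have cDx : #|D :\ x| = n by move: cD; rewrite (cardsD1 x) xD => -[].
have dis : [disjoint D :\ x & [set x]].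
  by rewrite disjoints_subset; apply/subsetP => y; rewrite !inE => /andP[].
rewrite -(setD1K xD) setUC bern_meanU // IH //.
have -> : bern_mean [set x] (fun=> 1) =
    \sum_(E in [set set0; [set x]]) bern_weight [set x] E.
  apply: eq_big => [E|E _]; last by rewrite mulr1.
  by rewrite powersetE subset1 !inE orbC.
rewrite big_setU1 ?big_set1 /=; last first.
  by rewrite inE; apply/eqP => /setP/(_ x); rewrite !inE eqxx.
by rewrite /bern_weight cards0 cards1 subn0 subnn; ring.
Qed.

Lemma bern_mean_cst D c : bern_mean D (fun=> c) = c.
Proof.
rewrite -[RHS]mulr1 -(bern_mean1 D) -bern_meanZ.
by apply: eq_bern_mean => E _; rewrite mulr1.
Qed.

Hypothesis p01 : 0 <= p <= 1.

Lemma bern_weight_ge0 D E : 0 <= bern_weight D E.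
Proof. by case/andP: p01 => p0 p1; rewrite mulr_ge0 ?exprn_ge0 // subr_ge0. Qed.

Lemma le_bern_mean D f g :
  (forall E, E \subset D -> f E <= g E) -> bern_mean D f <= bern_mean D g.
Proof.
move=> fg; apply: ler_sum => E; rewrite inE => /fg h.
exact: ler_wpM2l (bern_weight_ge0 _ _) _ _ h.
Qed.

Lemma bern_pr_ge0 D A : 0 <= bern_pr D A.
Proof. by rewrite -(bern_mean_cst D 0); apply: le_bern_mean => E _; rewrite ler0n. Qed.

Lemma bern_pr_le1 D A : bern_pr D A <= 1.
Proof. by rewrite -(bern_mean1 D); apply: le_bern_mean => E _; rewrite lern1; case: (_ \in _). Qed.

Lemma le_bern_pr D A A' :
  (forall E, E \subset D -> E \in A -> E \in A') -> bern_pr D A <= bern_pr D A'.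
Proof.
move=> AA'; apply: le_bern_mean => E /AA'; rewrite ler_nat.
by case: (_ \in A) => //; case: (_ \in A') => // /(_ isT).
Qed.

(* Hoelder's inequality in logarithmic form: after normalisation it is the
   pointwise convexity of [expR]. *)
Lemma bern_mean_expR_convex D X Y a b lam : 0 <= lam <= 1 ->
  bern_mean D (fun E => expR (X E)) <= expR a ->
  bern_mean D (fun E => expR (Y E)) <= expR b ->
  bern_mean D (fun E => expR (lam * X E + (1 - lam) * Y E))
    <= expR (lam * a + (1 - lam) * b).
Proof.
move=> /andP[l0 l1] hX hY.
have norm Z c : bern_mean D (fun E => expR (Z E)) <= expR c ->
    bern_mean D (fun E => expR (Z E - c)) <= 1.
  move=> h; rewrite (@eq_bern_mean _ _ (fun E => expR (- c) * expR (Z E))).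
    rewrite bern_meanZ expRN ler_pdivrMl ?expR_gt0 ?mulr1 //.
  by move=> E _; rewrite -exp.expRD addrC.
set c := lam * a + _.
rewrite -[leRHS]mulr1 -ler_pdivrMl ?expR_gt0 // -expRN -bern_meanZ.
apply: (@le_trans _ _ (bern_mean D (fun E =>
  lam * expR (X E - a) + (1 - lam) * expR (Y E - b)))); last first.
  by rewrite bern_meanD !bern_meanZ; have := norm _ _ hX; have := norm _ _ hY; nra.
apply: le_bern_mean => E _; rewrite -exp.expRD.
set x := X E - a; set y := Y E - b.
have -> : - c + (lam * X E + (1 - lam) * Y E) = lam * x + (1 - lam) * y.
  by rewrite /c /x /y; ring.
set m := lam * x + _.
(* The tangent line of [expR] at the weighted mean [m] of [x] and [y]; in the weighted sum of its
   values at [x] and [y] the linear terms cancel. *)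
have tangent t : expR m * (1 + (t - m)) <= expR t.
  have -> : expR t = expR m * expR (t - m) by rewrite -exp.expRD addrC subrK.
  rewrite ler_wpM2l ?expR_ge0 //.
  exact: expR_ge1Dx.
have := ler_wpM2l l0 (tangent x); have l1' : 0 <= 1 - lam by lra.
have := ler_wpM2l l1' (tangent y).
suff : lam * (expR m * (1 + (x - m))) + (1 - lam) * (expR m * (1 + (y - m))) = expR m by lra.
by rewrite /m; ring.
Qed.

End BernoulliSubset.

(** * Talagrand's inequality *)

Section Talagrand.
Variables (K : realType) (T : finType) (p : K).
Variables (U : {set T}) (blk : T -> nat).
Hypothesis p01 : 0 <= p <= 1.
Implicit Types (E F : {set T}) (A : {set {set T}}) (s : nat -> K).

(** Blocks are the coordinates of a product space: the trace of a random subset of [U] on [block k]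
    is its coordinate [k], and [blocks_lt k] carries the first [k] coordinates. *)
Definition block k := [set x in U | blk x == k].
Definition blocks_lt k := [set x in U | (blk x < k)%N].

Definition differ E E' i := E :&: block i != E' :&: block i.

(* By the minimax theorem this says that [s] dominates coordinatewise a point
   of the convex hull of the difference patterns of [E] with the elements of
   [A]; the minimum of [\sum_i s i ^+ 2] is Talagrand's squared convex
   distance. Working with this dual form avoids convex hulls altogether. *)
Definition dominates k A E s :=
  forall al : nat -> K, (forall i, 0 <= al i) ->
  exists2 E', E' \in A &
    \sum_(i < k | differ E E' i) al i <= \sum_(i < k) al i * s i.

Lemma blocks_lt0 : blocks_lt 0 = finset.set0.
Proof. by apply/setP => x; rewrite !inE ltn0 andbF. Qed.

Lemma blocks_ltS k : blocks_lt k.+1 = blocks_lt k :|: block k.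
Proof.
by apply/setP => x; rewrite !inE ltnS leq_eqVlt -andb_orr orbC.
Qed.

Lemma disjoint_blocks_lt_block k i : (k <= i)%N -> [disjoint blocks_lt k & block i].
Proof.
move=> ki; rewrite disjoints_subset; apply/subsetP => x; rewrite !inE.
move=> /andP[-> xk] /=; apply: contraTN xk => /eqP ->.
by rewrite -leqNgt.
Qed.

Lemma blockU_lt k E F i : F \subset block k -> (i < k)%N ->
  (E :|: F) :&: block i = E :&: block i.
Proof.
move=> FB ik; rewrite setIUl (_ : F :&: _ = finset.set0) ?setU0 //.
apply/setP => x; rewrite !inE; apply/negP => /andP[xF /andP[_ /eqP xi]].
by have := subsetP FB _ xF; rewrite inE xi => /andP[_ /eqP ?]; lia.
Qed.

Lemma blockU_eq k E F : E \subset blocks_lt k -> F \subset block k ->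
  (E :|: F) :&: block k = F.
Proof.
move=> EP FB; rewrite setIUl (setIidPl FB).
by rewrite disjoint_setI0 ?set0U // (disjointWl EP) // disjoint_blocks_lt_block.
Qed.

Lemma blocks_ltU k E F : E \subset blocks_lt k -> F \subset block k ->
  (E :|: F) :&: blocks_lt k = E.
Proof.
move=> EP FB; rewrite setIUl (setIidPl EP).
rewrite (_ : F :&: _ = finset.set0) ?setU0 //.
by rewrite setIC disjoint_setI0 // (disjointWr FB) // disjoint_blocks_lt_block.
Qed.

Lemma eq_dominates k A E s s' : (forall i, (i < k)%N -> s i = s' i) ->
  dominates k A E s -> dominates k A E s'.
Proof.
move=> ss' h al al0; have [E' E'A le] := h al al0; exists E' => //.
by rewrite (le_trans le) // ler_sum // => i _; rewrite ss'.
Qed.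

(** The smaller of two bounds is at most their weighted average, so for each [al] one of the two
    given witnesses already serves. *)
Lemma dominates_convex k A E s t lam : 0 <= lam <= 1 ->
  dominates k A E s -> dominates k A E t ->
  dominates k A E (fun i => lam * s i + (1 - lam) * t i).
Proof.
move=> /andP[l0 l1] hs ht al al0.
have [E1 E1A le1] := hs al al0; have [E2 E2A le2] := ht al al0.
have -> : \sum_(i < k) al i * (lam * s i + (1 - lam) * t i) =
  lam * (\sum_(i < k) al i * s i) + (1 - lam) * (\sum_(i < k) al i * t i).
  by rewrite !big_distrr -big_split; apply: eq_bigr => i _ /=; ring.
set a := \sum_(i < k) _ in le1 *; set b := \sum_(i < k) _ in le2 *.
have [ab|ba] := leP a b.
  by exists E1 => //; apply: le_trans le1 _; nra.
by exists E2 => //; apply: le_trans le2 _; nra.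
Qed.

(** A witness from the section over [F] is completed by [F] itself, so the last coordinate agrees
    and costs 0. *)
Lemma dominates_section k A E F s :
  E \subset blocks_lt k -> F \subset block k ->
  dominates k [set E' in powerset (blocks_lt k) | E' :|: F \in A] E s ->
  dominates k.+1 A (E :|: F) (fun i => if (i < k)%N then s i else 0).
Proof.
move=> EP FB h al al0; have [E'] := h al al0.
rewrite !inE => /andP[E'P E'A] le; exists (E' :|: F) => //.
rewrite big_mkcond !big_ord_recr /= ltnn mulr0 addr0.
rewrite /differ !blockU_eq // eqxx addr0 -big_mkcond /=.
apply: le_trans (le_trans le _).
  by rewrite le_eqVlt; apply/orP; left; apply/eqP; apply: eq_bigl => i;
     rewrite /differ !(blockU_lt _ FB).
by apply: ler_sum => i _; rewrite ltn_ord.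
Qed.

(** A witness from the projection is completed by some [F'] that may differ from [F], so the last
    coordinate is charged 1. *)
Lemma dominates_projection k A E F s :
  E \subset blocks_lt k -> F \subset block k ->
  dominates k [set E' in powerset (blocks_lt k) |
    [exists F' in powerset (block k), E' :|: F' \in A]] E s ->
  dominates k.+1 A (E :|: F) (fun i => if (i < k)%N then s i else 1).
Proof.
move=> EP FB h al al0; have [E'] := h al al0.
rewrite !inE => /andP[E'P /existsP[F' /andP[]]]; rewrite inE => F'B E'A le.
exists (E' :|: F') => //.
rewrite big_mkcond !big_ord_recr /= ltnn mulr1 lerD //; last first.
  by case: ifP.
rewrite -big_mkcond /=; apply: le_trans (le_trans le _).
  by rewrite le_eqVlt; apply/orP; left; apply/eqP; apply: eq_bigl => i;
     rewrite /differ (blockU_lt _ FB) // (blockU_lt _ F'B).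
by apply: ler_sum => i _; rewrite ltn_ord.
Qed.

Lemma bern_prS k A :
  bern_pr p (blocks_lt k.+1) A = bern_mean p (block k) (fun F =>
    bern_pr p (blocks_lt k) [set E in powerset (blocks_lt k) | E :|: F \in A]).
Proof.
rewrite /bern_pr blocks_ltS bern_meanU ?disjoint_blocks_lt_block //.
apply: eq_bern_mean => F _; apply: eq_bern_mean => E EP.
by rewrite inE powersetE EP.
Qed.

Lemma sqr_convex_sum k s t lam : 0 <= lam <= 1 ->
  \sum_(i < k) (lam * s i + (1 - lam) * t i) ^+ 2 <=
  lam * (\sum_(i < k) s i ^+ 2) + (1 - lam) * (\sum_(i < k) t i ^+ 2).
Proof.
move=> /andP[l0 l1]; rewrite !big_distrr -big_split ler_sum // => i _ /=.
have : 0 <= lam * (1 - lam) * (s i - t i) ^+ 2.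
  by rewrite mulr_ge0 ?sqr_ge0 ?mulr_ge0 ?subr_ge0.
by rewrite !expr2; lra.
Qed.

Lemma talagrand_convex_distance k A :
  A \subset powerset (blocks_lt k) -> 0 < bern_pr p (blocks_lt k) A ->
  exists s : {set T} -> nat -> K,
    (forall E, E \subset blocks_lt k -> dominates k A E (s E)) /\
    bern_mean p (blocks_lt k) (fun E => expR ((\sum_(i < k) s E i ^+ 2) / 5))
      <= (bern_pr p (blocks_lt k) A)^-1.
Proof.
elim: k A => [|k IH] A.
  rewrite blocks_lt0 => _ A0; exists (fun _ _ => 0); split.
    move=> E; rewrite subset0 => /eqP -> al al0; rewrite !big_ord0.
    exists finset.set0; last by rewrite big_pred0 // => -[].
    apply/negPn/negP => nA; move: A0; rewrite /bern_pr.
    rewrite (@eq_bern_mean _ _ _ _ _ (fun=> 0)) ?bern_mean_cst ?ltxx //.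
    by move=> G; rewrite subset0 => /eqP ->; rewrite (negbTE nA).
  rewrite (@eq_bern_mean _ _ _ _ _ (fun=> 1)) ?bern_mean_cst.
    by rewrite invf_ge1 // bern_pr_le1.
  by move=> E _; rewrite big_ord0 mul0r exp.expR0.
move=> AP A0.
pose sec F := [set E in powerset (blocks_lt k) | E :|: F \in A].
pose C := [set E in powerset (blocks_lt k) |
    [exists F in powerset (block k), E :|: F \in A]].
pose PC := bern_pr p (blocks_lt k) C.
pose PF F := bern_pr p (blocks_lt k) (sec F).
have PFC F : F \subset block k -> PF F <= PC.
  move=> FB; apply: le_bern_pr => // E EP; rewrite !inE => /andP[-> EA] /=.
  by apply/existsP; exists F; rewrite inE FB.
have PAE : bern_pr p (blocks_lt k.+1) A = bern_mean p (block k) PF by exact: bern_prS.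
have PAC : bern_pr p (blocks_lt k.+1) A <= PC.
  by rewrite PAE -[leRHS](bern_mean_cst p (block k)); apply: le_bern_mean.
have PC0 : 0 < PC by apply: lt_le_trans PAC.
have [sC [domC expC]] : exists s : {set T} -> nat -> K,
    (forall E, E \subset blocks_lt k -> dominates k C E (s E)) /\
    bern_mean p (blocks_lt k) (fun E => expR ((\sum_(i < k) s E i ^+ 2) / 5)) <= PC^-1.
  by apply: IH => //; apply/subsetP => E; rewrite inE => /andP[].
have step F : exists s : {set T} -> nat -> K, F \subset block k ->
    (forall E, E \subset blocks_lt k -> dominates k.+1 A (E :|: F) (s E)) /\
    bern_mean p (blocks_lt k) (fun E => expR ((\sum_(i < k.+1) s E i ^+ 2) / 5))
      <= PC^-1 * (2 - PF F / PC).
  have [FB|] := boolP (F \subset block k); last by exists (fun _ _ => 0).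
  have [lam [sF [l01 [domF [a [expF le2]]]]]] : exists lam sF, 0 <= lam <= 1 /\
      ((forall E, E \subset blocks_lt k -> lam = 0 \/ dominates k (sec F) E (sF E)) /\
      exists a, bern_mean p (blocks_lt k)
        (fun E => expR ((\sum_(i < k) sF E i ^+ 2) / 5)) <= expR a /\
      expR ((1 - lam) ^+ 2 / 5 + lam * (a + ln PC)) <= 2 - PF F / PC).
    have [PF0|PF0] := ltP 0 (PF F).
      have [sF [domF expF]] := IH (sec F)
        ltac:(by apply/subsetP => E; rewrite inE => /andP[]) PF0.
      have r0 : 0 < PF F / PC by rewrite divr_gt0.
      have r1 : PF F / PC <= 1 by rewrite ler_pdivrMr // mul1r PFC.
      have [lam l01 le2] := talagrand_exponent r0 r1.
      exists lam, sF; split=> //; split; first by right; exact: domF.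
      exists (- ln (PF F)); split; first by rewrite expRN lnK.
      apply: le_trans le2; rewrite ler_expR ln_div // le_eqVlt.
      by apply/orP; left; apply/eqP; ring.
    (* Over a null section the induction hypothesis says nothing. The choice [lam = 0] uses the
       projection alone, and [expR 5^-1 <= 2] suffices. *)
    have -> : PF F = 0 by apply/eqP; rewrite eq_le PF0 bern_pr_ge0.
    exists 0, (fun _ _ => 0); split; first by rewrite lexx ler01.
    split; first by left.
    exists 0; split.
      rewrite (@eq_bern_mean _ _ _ _ _ (fun=> 1)) ?bern_mean_cst ?exp.expR0 //.
      by move=> E _; rewrite big1 ?mul0r ?exp.expR0 // => i _; rewrite expr0n.
    rewrite mul0r subr0 expr1n mul1r mul0r subr0 addr0.
    apply: le_trans (@expR_le_invsq _ (5^-1 : K) ltac:(lra)) _.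
    by rewrite -[_^-1]mul1r ler_pdivrMr expr2; lra.
  exists (fun E i => lam * (if (i < k)%N then sF E i else 0) +
    (1 - lam) * (if (i < k)%N then sC E i else 1)) => _; split.
    move=> E EP; have dC := dominates_projection EP FB (domC E EP).
    case: (domF E EP) => [l0|dF]; last first.
      exact: dominates_convex l01 (dominates_section EP FB dF) dC.
    by apply: eq_dominates dC => i ik; rewrite l0 mul0r subr0 mul1r add0r.
  have expC' : bern_mean p (blocks_lt k)
      (fun E => expR ((\sum_(i < k) sC E i ^+ 2) / 5)) <= expR (- ln PC).
    by rewrite expRN lnK.
  have := bern_mean_expR_convex p01 l01 expF expC'.
  set M := bern_mean _ _ _ => hM.
  apply: (@le_trans _ _ (expR ((1 - lam) ^+ 2 / 5) * M)).
    rewrite -bern_meanZ; apply: le_bern_mean => // E EP.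
    rewrite -exp.expRD ler_expR big_ord_recr /= ltnn mulr0 add0r mulr1.
    have := @sqr_convex_sum k (sF E) (sC E) lam l01.
    under [X in _ -> (X + _) / 5 <= _]eq_bigr do rewrite ltn_ord.
    by lra.
  apply: (@le_trans _ _ (expR (- ln PC) *
      expR ((1 - lam) ^+ 2 / 5 + lam * (a + ln PC)))); last first.
    by rewrite expRN lnK // ler_wpM2l // invr_ge0 ltW.
  apply: le_trans (ler_wpM2l (expR_ge0 _) hM) _.
  rewrite -!exp.expRD ler_expR le_eqVlt; apply/orP; left; apply/eqP; ring.
have [s hs] := choice step.
(* Glue the vectors chosen for the separate values of the last block. *)
exists (fun G => s (G :&: block k) (G :&: blocks_lt k)); split.
  move=> G; rewrite blocks_ltS => GP.
  have GE : G = (G :&: blocks_lt k) :|: (G :&: block k).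
    by rewrite -setIUr (setIidPl GP).
  rewrite {1}GE; apply (hs (G :&: block k) (subsetIr _ _)); exact: subsetIr.
rewrite {1}blocks_ltS bern_meanU ?disjoint_blocks_lt_block //.
apply: (@le_trans _ _ (bern_mean p (block k) (fun F => PC^-1 * (2 - PF F / PC)))).
  apply: le_bern_mean => // F FB; have [_] := hs F FB.
  apply: le_trans; apply: le_bern_mean => // E EP.
  by rewrite blockU_eq // blocks_ltU.
have -> : bern_mean p (block k) (fun F => PC^-1 * (2 - PF F / PC)) =
    PC^-1 * (2 - bern_pr p (blocks_lt k.+1) A / PC).
  rewrite bern_meanZ bern_meanD bern_mean_cst PAE; congr (_ * (_ + _)).
  rewrite (@eq_bern_mean _ _ _ _ _ (fun F => - PC^-1 * PF F)) => [|F _]; last by ring.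
  by rewrite bern_meanZ; ring.
move: PAC A0; set P := bern_pr _ _ _ => PAC A0.
(* What remains is [P * (2 * PC - P) <= PC ^+ 2], that is, [0 <= (PC - P) ^+ 2]. *)
have -> : PC^-1 * (2 - P / PC) = (2 * PC - P) / PC ^+ 2 by field; lra.
rewrite ler_pdivrMr ?exprn_gt0 // [leRHS]mulrC ler_pdivlMr //.
by have := sqr_ge0 (PC - P); rewrite !expr2; lra.
Qed.

(** Markov's inequality for the exponential moment: for [E] in [B], pairing a dominating vector with
    [al] gives at least [tau], so by Cauchy-Schwarz its squared norm is at least [tau ^+ 2]. *)
Lemma talagrand_two_sets k A (B : {set {set T}}) (tau : K) : 0 <= tau ->
  A \subset powerset (blocks_lt k) ->
  (forall E, E \in B -> exists2 al : nat -> K,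
     (forall i, 0 <= al i) /\ \sum_(i < k) al i ^+ 2 <= 1 &
     forall E', E' \in A -> tau <= \sum_(i < k | differ E E' i) al i) ->
  bern_pr p (blocks_lt k) A * bern_pr p (blocks_lt k) B <= expR (- (tau ^+ 2 / 5)).
Proof.
move=> tau0 AP hB.
have [A0|A0] := ltP 0 (bern_pr p (blocks_lt k) A); last first.
  by rewrite (le_trans (mulr_le0_ge0 A0 (bern_pr_ge0 p01 _ _))) ?expR_ge0.
have [s [dom mean]] := talagrand_convex_distance AP A0.
rewrite mulrC -ler_pdivlMr // expRN mulrC ler_pdivlMr ?expR_gt0 //.
apply: le_trans mean.
rewrite mulrC -bern_meanZ; apply: le_bern_mean => // E EP.
have [EB|_] := boolP (E \in B); last by rewrite mulr0 expR_ge0.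
rewrite mulr1 ler_expR ler_wpM2r ?invr_ge0 //.
have [al [al0 al1] hal] := hB E EB.
have [E' E'A le] := dom E EP al al0.
have {}le := le_trans (hal E' E'A) le.
set S := \sum_(i < k) _ ^+ 2.
have : 0 <= \sum_(i < k) (tau * al i - s E i) ^+ 2.
  by apply: sumr_ge0 => i _; exact: sqr_ge0.
have -> : \sum_(i < k) (tau * al i - s E i) ^+ 2 =
  tau ^+ 2 * (\sum_(i < k) al i ^+ 2) - 2 * tau * (\sum_(i < k) al i * s E i) + S.
  by rewrite !big_distrr -sumrB -big_split; apply: eq_bigr => i _ /=; ring.
set X := \sum_(i < k) _ in al1 *; set Y := \sum_(i < k) _ in le *.
have := ler_wpM2l (sqr_ge0 tau) al1; have := ler_wpM2l tau0 le.
by rewrite !expr2; lra.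
Qed.

End Talagrand.

(** * Sublinear functionals and Gram matrices *)

Section Sublinear.
Variables (K : realType) (V : lmodType K).
Implicit Types (q r : V -> K) (x y e : V).

(** Homogeneity is required as an inequality only; scaling back by the inverse gives the converse in
    [sublinearZ_ge]. *)
Definition sublinear q :=
  (forall x y, q (x + y) <= q x + q y) /\
  (forall c x, 0 <= c -> q (c *: x) <= c * q x).

Lemma sublinear0_ge0 q : sublinear q -> 0 <= q 0.
Proof. by case=> qD _; have := qD 0 0; rewrite addr0; lra. Qed.

Lemma sublinear0_le0 q : sublinear q -> q 0 <= 0.
Proof. by case=> _ /(_ 0 0 (lexx _)); rewrite scale0r mul0r. Qed.

Lemma sublinearZ_ge q c x : sublinear q -> 0 <= c -> c * q x <= q (c *: x).
Proof.
move=> sq; rewrite le_eqVlt => /predU1P[<-|c0].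
  by rewrite mul0r scale0r sublinear0_ge0.
rewrite -ler_pdivlMl //; have := sq.2 c^-1 (c *: x).
by rewrite scalerA mulVf ?gt_eqF // scale1r invr_ge0 ltW //; apply.
Qed.

Lemma sublinear_sum q n (F : 'I_n -> V) : sublinear q ->
  q (\sum_i F i) <= \sum_i q (F i).
Proof.
move=> sq; elim/big_ind2: _ => //; first exact: sublinear0_le0.
by move=> x1 x2 y1 y2 h1 h2; rewrite (le_trans (sq.1 _ _)) // lerD.
Qed.

(* The directional regularisation [r x = inf_(t >= 0) (q (x + t e) - t q e)]
   is sublinear and additive along [e]. *)
Lemma sublinear_direct q e : sublinear q ->
  exists r, [/\ sublinear r, forall x, r x <= q x & r (- e) <= - q e].
Proof.
move=> sq.
pose S x := [set y | exists2 t : K, 0 <= t & y = q (x + t *: e) - t * q e]%classic.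
have S0 x : (S x !=set0)%classic by exists (q (x + 0 *: e) - 0 * q e); exists 0.
have lbS x : has_lbound (S x).
  exists (- q (- x)) => _ [t t0 ->].
  have := sublinearZ_ge e sq t0; have := sq.1 (x + t *: e) (- x).
  by rewrite addrAC subrr add0r; lra.
have infS x t : 0 <= t -> inf (S x) <= q (x + t *: e) - t * q e.
  by move=> t0; apply: ge_inf => //; exists t.
have le_infS x (b : K) : (forall t, 0 <= t -> b <= q (x + t *: e) - t * q e) ->
    b <= inf (S x).
  by move=> hb; apply: lb_le_inf => // _ [t t0 ->]; exact: hb.
exists (fun x => inf (S x)); split; first split.
- move=> x y; rewrite -lerBlDr; apply: (le_infS) => t t0; rewrite lerBlDr.
  rewrite -lerBlDl; apply: (le_infS) => u u0; rewrite lerBlDl.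
  (* Parameters [t] for [x] and [u] for [y] combine to [t + u] for [x + y]. *)
  apply: le_trans (infS _ (t + u) (addr_ge0 t0 u0)) _.
  have -> : x + y + (t + u) *: e = (x + t *: e) + (y + u *: e).
    by rewrite scalerDl addrACA.
  by have := sq.1 (x + t *: e) (y + u *: e); lra.
- move=> c x; rewrite le_eqVlt => /predU1P[<-|c0].
    rewrite scale0r mul0r; apply: le_trans (infS 0 0 (lexx _)) _.
    by rewrite scale0r addr0 mul0r subr0 sublinear0_le0.
  rewrite -ler_pdivrMl //; apply: (le_infS) => t t0; rewrite ler_pdivrMl //.
  apply: le_trans (infS _ (c * t) (mulr_ge0 (ltW c0) t0)) _.
  rewrite -scalerA -scalerDr.
  by have := sq.2 c (x + t *: e) (ltW c0); lra.
- by move=> x; have := infS x 0 (lexx _); rewrite scale0r addr0 mul0r subr0.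
- have := infS (- e) 1 ler01; rewrite scale1r addNr mul1r.
  by have := sublinear0_le0 sq; lra.
Qed.

(** Regularise along one vector after another. Later steps only decrease the functional, so
    [r e + r (- e) <= 0] survives for the earlier directions. *)
Lemma sublinear_direct_seq q (es : seq V) : sublinear q ->
  exists r, [/\ sublinear r, forall x, r x <= q x &
    forall e, e \in es -> r e + r (- e) <= 0].
Proof.
elim: es q => [|e es IH] q sq; first by exists q.
have [q1 [sq1 q1q q1e]] := sublinear_direct e sq.
have [r [sr rq1 re]] := IH _ sq1.
exists r; split=> // [x|f]; first exact: le_trans (q1q x).
rewrite inE => /predU1P[->|]; last exact: re.
by have := rq1 e; have := rq1 (- e); have := q1q e; lra.
Qed.

End Sublinear.

(** Regularising along [x0] first secures contact with [q] at [x0]; regularising along the basis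
    vectors then makes the functional linear, and [b] lists its values on the basis. *)
Lemma hahn_banach_row (K : realType) n (q : 'rV[K]_n -> K) (x0 : 'rV[K]_n) :
  sublinear q ->
  exists b : 'I_n -> K, (forall x : 'rV[K]_n, \sum_i b i * x 0 i <= q x) /\
    q x0 <= \sum_i b i * x0 0 i.
Proof.
move=> sq.
have [q1 [sq1 q1q q1x0]] := sublinear_direct x0 sq.
have [r [sr rq1 re]] :=
  sublinear_direct_seq [seq (delta_mx 0 i : 'rV[K]_n) | i <- enum 'I_n] sq1.
pose b i := r (delta_mx 0 i).
have bN i : r (- delta_mx 0 i) <= - b i.
  have := re (delta_mx 0 i); rewrite map_f ?mem_enum // => /(_ isT).
  by rewrite -/(b i); lra.
have rZ c i : r (c *: delta_mx 0 i) <= b i * c.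
  have [c0|c0] := leP 0 c; first by rewrite mulrC sr.2.
  rewrite -[c]opprK scaleNr -scalerN.
  have c0' : 0 <= - c by lra.
  apply: le_trans (sr.2 _ _ c0') _.
  by have := ler_wpM2l c0' (bN i); lra.
have rle (x : 'rV[K]_n) : r x <= \sum_i b i * x 0 i.
  rewrite {1}(row_sum_delta x); apply: le_trans (sublinear_sum _ sr) _.
  by apply: ler_sum => i _; exact: rZ.
have rge (x : 'rV[K]_n) : \sum_i b i * x 0 i <= r x.
  have := rle (- x); have := sr.1 x (- x); rewrite subrr.
  have := sublinear0_ge0 sr.
  have -> : \sum_i b i * (- x) 0 i = - \sum_i b i * x 0 i.
    by rewrite -sumrN; apply: eq_bigr => i _; rewrite mxE mulrN.
  by lra.
exists b; split=> [x|]; first by apply: le_trans (rge x) (le_trans (rq1 x) (q1q x)).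
have := rge (- x0); have := rq1 (- x0).
have -> : \sum_i b i * (- x0) 0 i = - \sum_i b i * x0 0 i.
  by rewrite -sumrN; apply: eq_bigr => i _; rewrite mxE mulrN.
by lra.
Qed.

Lemma sum_indicatorM (A : pzRingType) n (i : 'I_n) (f : 'I_n -> A) :
  \sum_j (j == i)%:R * f j = f i.
Proof.
rewrite (bigD1 i) //= eqxx mul1r big1 ?addr0 // => j /negPf ->.
by rewrite mul0r.
Qed.

Lemma indicator_form (A : pzRingType) n (i : 'I_n) (M : 'I_n -> 'I_n -> A) :
  \sum_j \sum_l (j == i)%:R * (l == i)%:R * M j l = M i i.
Proof.
under eq_bigr do under eq_bigr do rewrite -mulrA.
under eq_bigr do rewrite -big_distrr sum_indicatorM.
exact: sum_indicatorM.
Qed.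

(** Cholesky factorisation: split off the first row and apply induction to the Schur complement,
    which is again positive semidefinite. *)
Lemma gram_of_psd (K : realType) n (M : 'I_n -> 'I_n -> K) :
  (forall i j, M i j = M j i) ->
  (forall x : 'I_n -> K, 0 <= \sum_i \sum_j x i * x j * M i j) ->
  exists v : 'I_n -> 'I_n -> K, forall i j, \sum_l v i l * v j l = M i j.
Proof.
elim: n M => [|n IH] M symM psdM; first by exists (fun _ _ => 0) => -[].
pose a := M ord0 ord0; pose b i := M ord0 (lift ord0 i).
pose C i j := M (lift ord0 i) (lift ord0 j).
have form x0 (x : 'I_n -> K) :
    0 <= a * x0 ^+ 2 + 2 * x0 * (\sum_i x i * b i) + \sum_i \sum_j x i * x j * C i j.
  have := psdM (fun i => if unlift ord0 i is Some i' then x i' else x0).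
  rewrite !big_ord_recl unlift_none.
  under eq_bigr do rewrite liftK.
  under [X in _ + X]eq_bigr do rewrite big_ord_recl unlift_none liftK.
  rewrite big_split /=.
  under [X in _ + (_ + X)]eq_bigr do under eq_bigr do rewrite liftK.
  rewrite -/a => h; apply: le_trans h _; rewrite le_eqVlt; apply/orP; left; apply/eqP.
  rewrite addrA; congr (_ + _); rewrite -addrA; congr (_ + _); first ring.
  rewrite big_distrr -big_split; apply: eq_bigr => i _ /=.
  by rewrite (symM (lift ord0 i)) -/(b i); ring.
have a0 : 0 <= a.
  have := form 1 (fun _ => 0); rewrite !big1 => [|i _|i _]; first by rewrite expr1n; lra.
    by rewrite big1 // => j _; rewrite !mul0r.
  by rewrite mul0r.
have b0 i : a = 0 -> b i = 0.
  move=> az; have h t := form t (fun j => (j == i)%:R).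
  have h' t : 0 <= 2 * t * b i + C i i.
    by move: (h t); rewrite az mul0r add0r sum_indicatorM indicator_form.
  apply/eqP/negPn/negP => bn.
  (* At this [t] the nonnegative affine function [2 * t * b i + C i i] would equal -1. *)
  have := h' (- (C i i + 1) / (2 * b i)).
  have -> : 2 * (- (C i i + 1) / (2 * b i)) * b i = - (C i i + 1) by field.
  by lra.
have sab i : Num.sqrt a * (b i / Num.sqrt a) = b i.
  have [az|an] := eqVneq a 0; first by rewrite (b0 i az) mul0r mulr0.
  by rewrite mulrCA divff ?mulr1 // sqrtr_eq0 -ltNge lt_def an.
have [|x|w hw] := IH (fun i j => C i j - (b i / Num.sqrt a) * (b j / Num.sqrt a)).
- by move=> i j; rewrite /C symM mulrC.
- set g := fun i => b i / Num.sqrt a in sab *.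
  have -> : \sum_i \sum_j x i * x j * (C i j - g i * g j) =
      \sum_i \sum_j x i * x j * C i j - (\sum_i x i * g i) ^+ 2.
    rewrite expr2 big_distrlr -sumrB; apply: eq_bigr => i _.
    by rewrite -sumrB; apply: eq_bigr => j _ /=; ring.
  have [az|an] := eqVneq a 0.
    have -> : \sum_i x i * g i = 0.
      by rewrite big1 // => i _; rewrite /g b0 // mul0r mulr0.
    by have := form 0 x; rewrite az expr2; lra.
  have s0 : Num.sqrt a != 0 by rewrite sqrtr_eq0 -ltNge lt_def an.
  (* The first coordinate that minimises the quadratic form for given [x]. *)
  have := form (- (\sum_i x i * g i) / Num.sqrt a) x.
  have -> : \sum_i x i * b i = Num.sqrt a * (\sum_i x i * g i).
    by rewrite big_distrr; apply: eq_bigr => i _ /=; rewrite mulrCA sab.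
  set G := \sum_i x i * g i.
  rewrite -[in X in X * _](sqr_sqrtr a0).
  have -> : Num.sqrt a ^+ 2 * (- G / Num.sqrt a) ^+ 2 +
    2 * (- G / Num.sqrt a) * (Num.sqrt a * G) = - G ^+ 2 by field.
  by rewrite addrC.
exists (fun i l => match unlift ord0 i, unlift ord0 l with
  | None, None => Num.sqrt a
  | None, Some _ => 0
  | Some i', None => b i' / Num.sqrt a
  | Some i', Some l' => w i' l' end) => i j.
rewrite big_ord_recl unlift_none.
under eq_bigr do rewrite liftK.
case: (unliftP ord0 i) => [i'|] ->; case: (unliftP ord0 j) => [j'|] ->.
- by rewrite hw addrC subrK.
- rewrite big1 ?addr0 => [|l _]; last by rewrite mulr0.
  by rewrite mulrC sab symM.
- by rewrite big1 ?addr0 ?sab // => l _; rewrite mul0r.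
- by rewrite big1 => [|l _]; rewrite ?mul0r // addr0 -expr2 sqr_sqrtr.
Qed.

(** * Weighted theta functions *)

Section WeightedTheta.
Variables (kd : vkind) (n : nat).
Implicit Types (e : rel 'I_n) (Q : 'I_n -> 'I_n -> R) (w : 'rV[R]_n).

(** These are the colouring conditions after an affine change of the Gram entries that moves
    [- (k - 1)^-1] to 0. They no longer mention [k] and define a convex cone. *)
Definition sign_pattern e Q : Prop :=
  match kd with
  | VecCol => forall i j, e i j -> Q i j <= 0
  | StrictCol => forall i j, e i j -> Q i j = 0
  | RigidCol => (forall i j, e i j -> Q i j = 0) /\
                (forall i j, i != j -> ~~ e i j -> 0 <= Q i j)
  end.

Lemma sign_patternD e Q Q' : sign_pattern e Q -> sign_pattern e Q' ->
  sign_pattern e (fun i j => Q i j + Q' i j).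
Proof.
rewrite /sign_pattern; case: kd => [h h' i j ij|h h' i j ij|[h k] [h' k']].
- by have := h _ _ ij; have := h' _ _ ij; lra.
- by rewrite h // h' // addr0.
- split=> i j ij; first by rewrite h // h' // addr0.
  by move=> eij; rewrite addr_ge0 ?k ?k'.
Qed.

Lemma sign_patternZ e (c : 'I_n -> 'I_n -> R) Q : (forall i j, 0 <= c i j) ->
  sign_pattern e Q -> sign_pattern e (fun i j => c i j * Q i j).
Proof.
move=> c0; rewrite /sign_pattern; case: kd => [h i j ij|h i j ij|[h k]].
- by rewrite mulr_ge0_le0 // h.
- by rewrite h // mulr0.
- split=> i j ij; first by rewrite h // mulr0.
  by move=> eij; rewrite mulr_ge0 // k.
Qed.

Lemma sign_pattern_diag e (d : 'I_n -> R) : irreflexive e ->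
  sign_pattern e (fun i j => if i == j then d i else 0).
Proof.
move=> irr; rewrite /sign_pattern.
have off i j : e i j -> (if i == j then d i else 0) = 0.
  by case: eqP => // <-; rewrite irr.
case: kd => [i j /off ->|//|]; first by [].
by split=> // i j /negPf ->.
Qed.

(* The quadratic form is that of the symmetric matrix [[t, z], [z, Q]]. Read
   its entries as inner products of vectors d, u_1, ..., u_n: for w = 1 the
   condition w_i <= 2 <d, u_i> - |u_i|^2 amounts, after rescaling u_i, to
   Lovasz's <d, u_i>^2 >= |u_i|^2, with theta = min |d|^2. Unlike the latter it
   is linear in the matrix, so the pairs (t, w) form a convex cone. *)
Definition feasible e (t : R) w : Prop :=
  exists (z : 'I_n -> R) Q,
  [/\ forall i j, Q i j = Q j i, sign_pattern e Q,
      forall i, w 0 i + Q i i <= 2 * z i &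
      forall (s : R) (x : 'I_n -> R),
        0 <= t * s ^+ 2 + 2 * s * (\sum_i z i * x i)
             + \sum_i \sum_j x i * x j * Q i j].

Lemma feasible_ge0 e t w : feasible e t w -> 0 <= t.
Proof.
case=> z [Q [_ _ _ /(_ 1 (fun=> 0))]].
rewrite !big1 => [|i _|i _]; first by rewrite expr1n; lra.
  by rewrite big1 // => j _; rewrite !mul0r.
by rewrite mulr0.
Qed.

Lemma feasibleD e t w t' w' : feasible e t w -> feasible e t' w' ->
  feasible e (t + t') (w + w').
Proof.
case=> z [Q [symQ sgQ wQ psd]] [z' [Q' [symQ' sgQ' wQ' psd']]].
exists (fun i => z i + z' i), (fun i j => Q i j + Q' i j); split.
- by move=> i j; rewrite symQ symQ'.
- exact: sign_patternD.
- by move=> i; rewrite mxE; have := wQ i; have := wQ' i; lra.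
- move=> s x; have := addr_ge0 (psd s x) (psd' s x).
  suff -> : \sum_i \sum_j x i * x j * (Q i j + Q' i j) =
      \sum_i \sum_j x i * x j * Q i j + \sum_i \sum_j x i * x j * Q' i j.
    suff -> : \sum_i (z i + z' i) * x i = \sum_i z i * x i + \sum_i z' i * x i.
      by lra.
    by rewrite -big_split; apply: eq_bigr => i _ /=; rewrite mulrDl.
  rewrite -big_split; apply: eq_bigr => i _; rewrite -big_split.
  by apply: eq_bigr => j _ /=; rewrite mulrDr.
Qed.

Lemma feasibleZ e c t w : 0 <= c -> feasible e t w -> feasible e (c * t) (c *: w).
Proof.
move=> c0 [z [Q [symQ sgQ wQ psd]]].
exists (fun i => c * z i), (fun i j => c * Q i j); split.
- by move=> i j; rewrite symQ.
- exact: sign_patternZ.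
- by move=> i; rewrite mxE; have := ler_wpM2l c0 (wQ i); lra.
- move=> s x; have := mulr_ge0 c0 (psd s x).
  suff -> : \sum_i \sum_j x i * x j * (c * Q i j) =
      c * \sum_i \sum_j x i * x j * Q i j.
    suff -> : \sum_i c * z i * x i = c * \sum_i z i * x i by lra.
    by rewrite big_distrr; apply: eq_bigr => i _ /=; rewrite mulrA.
  rewrite big_distrr; apply: eq_bigr => i _; rewrite big_distrr.
  by apply: eq_bigr => j _ /=; rewrite mulrCA.
Qed.

(** A diagonal matrix meets the sign pattern of every loopless graph, which gives easy feasible
    points. *)
Lemma feasible_diag e t w (z d : 'I_n -> R) : irreflexive e ->
  (forall i, w 0 i + d i <= 2 * z i) ->
  (forall s (x : 'I_n -> R), 0 <= t * s ^+ 2 + 2 * s * (\sum_i z i * x i)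
     + \sum_i d i * x i ^+ 2) ->
  feasible e t w.
Proof.
move=> irr wd psd; exists z, (fun i j => if i == j then d i else 0); split.
- by move=> i j; rewrite eq_sym; case: eqP => // ->.
- exact: sign_pattern_diag.
- by move=> i; rewrite eqxx.
- move=> s x; suff -> : \sum_i \sum_j x i * x j * (if i == j then d i else 0)
    = \sum_i d i * x i ^+ 2 by [].
  apply: eq_bigr => i _; rewrite (bigD1 i) //= eqxx big1 ?addr0; first by ring.
  by move=> j; rewrite eq_sym => /negPf ->; rewrite mulr0.
Qed.

Lemma feasible_exists e w : irreflexive e -> exists t, feasible e t w.
Proof.
(* With [Q] the identity, this [z] satisfies the weight condition, and [t = \sum_i z i ^+ 2] turns
   the form into a sum of squares. *)
move=> irr; pose z i := (`|w 0 i| + 1) / 2.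
exists (\sum_i z i ^+ 2); apply: (@feasible_diag _ _ _ z (fun=> 1)) => //.
  by move=> i; have := ler_norm (w 0 i); rewrite /z; lra.
move=> s x; suff -> : (\sum_i z i ^+ 2) * s ^+ 2 + 2 * s * (\sum_i z i * x i) +
    \sum_i 1 * x i ^+ 2 = \sum_i (z i * s + x i) ^+ 2.
  by apply: sumr_ge0 => i _; exact: sqr_ge0.
rewrite big_distrl big_distrr -!big_split; apply: eq_bigr => i _ /=; ring.
Qed.

Definition wtheta e w : R := inf [set t | feasible e t w]%classic.

Lemma wtheta_le e t w : feasible e t w -> wtheta e w <= t.
Proof. by move=> f; apply: ge_inf => //; exists 0 => u /feasible_ge0. Qed.

Lemma le_wtheta e w b : irreflexive e ->
  (forall t, feasible e t w -> b <= t) -> b <= wtheta e w.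
Proof. by move=> irr h; apply: lb_le_inf => //; exact: feasible_exists. Qed.

Lemma wtheta_sublinear e : irreflexive e -> sublinear (wtheta e).
Proof.
move=> irr; split=> [w w'|c w].
  rewrite -lerBlDr; apply: le_wtheta => // t ft; rewrite lerBlDr.
  rewrite -lerBlDl; apply: le_wtheta => // u fu; rewrite lerBlDl.
  exact/wtheta_le/feasibleD.
rewrite le_eqVlt => /predU1P[<-|c0].
  rewrite scale0r mul0r; have [t ft] := feasible_exists 0 irr.
  by rewrite -(mul0r t) -(scale0r (0 : 'rV[R]_n)); apply/wtheta_le/feasibleZ.
rewrite -ler_pdivrMl //; apply: le_wtheta => // t ft; rewrite ler_pdivrMl //.
exact/wtheta_le/feasibleZ/ft/ltW.
Qed.

(** This bound and the next one yield [0 <= b i <= 1] for a subgradient [b]. *)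
Lemma wtheta_deltaN e i : irreflexive e -> wtheta e (- delta_mx 0 i) <= 0.
Proof.
move=> irr; apply: wtheta_le.
apply: (@feasible_diag _ _ _ (fun=> 0) (fun=> 0)) => // [j|s x].
  by rewrite !mxE mulr0 addr0 oppr_le0 ler0n.
rewrite !big1 => [|j _|j _]; rewrite ?mul0r //.
by rewrite mulr0 !addr0.
Qed.

Lemma wtheta_delta e i : irreflexive e -> wtheta e (delta_mx 0 i) <= 1.
Proof.
move=> irr; apply: wtheta_le.
apply: (@feasible_diag _ _ _ (fun j => (j == i)%:R) (fun j => (j == i)%:R)) => //.
  by move=> j; rewrite !mxE /=; lra.
move=> s x; rewrite !sum_indicatorM; have := sqr_ge0 (s + x i); rewrite !expr2; lra.
Qed.

Lemma dotv_gram_ge0 (v : 'I_n -> 'rV[R]_n) (x : 'I_n -> R) :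
  0 <= \sum_i \sum_j x i * x j * dotv (v i) (v j).
Proof.
suff -> : \sum_i \sum_j x i * x j * dotv (v i) (v j) =
    \sum_l (\sum_i x i * v i 0 l) ^+ 2.
  by apply: sumr_ge0 => l _; exact: sqr_ge0.
under [RHS]eq_bigr do rewrite expr2 big_distrlr.
rewrite [RHS]exchange_big; apply: eq_bigr => i _ /=.
rewrite [RHS]exchange_big; apply: eq_bigr => j _ /=.
by rewrite /dotv big_distrr; apply: eq_bigr => l _ /=; ring.
Qed.

(** The entries [Y] have unit diagonal and move the threshold [- (k - 1)^-1] to 0. Zeroing the rows
    and columns outside [S] respects every sign pattern, so only the edges inside [S] matter and
    [e'] may replace [e]. *)
Lemma feasible_of_coloring e e' (S : pred 'I_n) k v : 1 < k ->
  is_coloring kd e' k v ->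
  (forall i j, S i -> S j -> e i j = e' i j) ->
  feasible e k (\row_i (S i)%:R).
Proof.
move=> k1 [v1 hv] ee'.
have kn : k - 1 != 0 by lra.
have k0 : k != 0 by lra.
pose Y i j := ((k - 1) * dotv (v i) (v j) + 1) / k.
have Yle i j : (Y i j <= 0) = (dotv (v i) (v j) <= - (k - 1)^-1).
  rewrite /Y ler_pdivrMr ?mul0r; last by lra.
  have -> : - (k - 1)^-1 = (-1) / (k - 1) by rewrite mulN1r.
  by rewrite ler_pdivlMr ?subr_gt0 //; apply/idP/idP; lra.
have Yge i j : (0 <= Y i j) = (- (k - 1)^-1 <= dotv (v i) (v j)).
  rewrite /Y ler_pdivlMr ?mul0r; last by lra.
  have -> : - (k - 1)^-1 = (-1) / (k - 1) by rewrite mulN1r.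
  by rewrite ler_pdivrMr ?subr_gt0 //; apply/idP/idP; lra.
have Yeq i j : dotv (v i) (v j) = - (k - 1)^-1 -> Y i j = 0.
  by move=> h; apply/eqP; rewrite eq_le Yle Yge h lexx.
exists (fun i => (S i)%:R), (fun i j => (S i && S j)%:R * Y i j); split.
- move=> i j; rewrite andbC /Y; congr (_ * ((_ * _ + 1) / k)).
  by apply: eq_bigr => l _; rewrite mulrC.
- have zero i j : (S i -> S j -> Y i j = 0) -> (S i && S j)%:R * Y i j = 0.
    by case: (S i); case: (S j) => /= h; rewrite ?mul0r // h ?mulr0.
  move: hv; rewrite /sign_pattern; case: kd => [h i j ij|h i j ij|[h h']].
  + case Si: (S i); case Sj: (S j) => /=; rewrite ?mul0r // mul1r Yle.
    by apply: h; rewrite -ee'.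
  + by apply: zero => Si Sj; apply/Yeq/h; rewrite -ee'.
  + split=> i j ij; first by apply: zero => Si Sj; apply/Yeq/h; rewrite -ee'.
    move=> eij; case Si: (S i); case Sj: (S j) => /=; rewrite ?mul0r // mul1r Yge.
    by apply: h' => //; rewrite -ee'.
- move=> i; rewrite mxE /Y v1; case: (S i) => /=; last by lra.
  have -> : ((k - 1) * 1 + 1) / k = 1 by field.
  by lra.
- move=> s x; pose x' i := (S i)%:R * x i.
  have -> : \sum_i \sum_j x i * x j * ((S i && S j)%:R * Y i j) =
      (k - 1) / k * (\sum_i \sum_j x' i * x' j * dotv (v i) (v j)) +
      (\sum_i x' i) ^+ 2 / k.
    rewrite expr2 big_distrlr !big_distrr big_distrl -big_split.
    apply: eq_bigr => i _; rewrite /= !big_distrr big_distrl -big_split.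
    by apply: eq_bigr => j _; rewrite /= /x' /Y -mulnb natrM; field.
  rewrite -/(x' _); set X := \sum_i x' i.
  have := dotv_gram_ge0 v x'; set G := \sum_i _ => G0.
  (* Completing the square in [s] leaves a nonnegative multiple of the Gram form. *)
  have -> : k * s ^+ 2 + 2 * s * X + ((k - 1) / k * G + X ^+ 2 / k) =
      ((k * s + X) ^+ 2 + (k - 1) * G) / k by field.
  rewrite divr_ge0 ?addr_ge0 ?sqr_ge0 ?mulr_ge0 //; lra.
Qed.

(** Divide row and column [i] of [Q] by [z i] to get [P]. The matrix with entries
    [(k * P i j - 1) / (k - 1)] is positive semidefinite with diagonal at most 1; the diagonal term
    [d] raises it to 1 without touching edges, and Gram vectors of the result form the colouring. *)
Lemma coloring_of_feasible e t k : irreflexive e -> feasible e t (const_mx 1) ->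
  t <= k -> 1 < k -> exists v, is_coloring kd e k v.
Proof.
move=> irr [z [Q [symQ sgQ wQ psd]]] tk k1.
have Qii i : 0 <= Q i i.
  have := psd 0 (fun j => (j == i)%:R).
  by rewrite indicator_form expr2; lra.
have z0 i : 0 < z i by have := wQ i; have := Qii i; rewrite mxE; lra.
pose c i j := (z i * z j)^-1.
have c0 i j : 0 < c i j by rewrite invr_gt0 mulr_gt0.
pose P i j := c i j * Q i j.
have sgP : sign_pattern e P by apply: sign_patternZ => // i j; exact: ltW.
have Pii i : P i i <= 1.
  rewrite /P /c ler_pdivrMl ?mulr_gt0 // mulr1.
  by have := wQ i; rewrite mxE; have := sqr_ge0 (z i - 1); rewrite expr2; lra.
have psdP (x : 'I_n -> R) : (\sum_i x i) ^+ 2 <= k * \sum_i \sum_j x i * x j * P i j.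
  (* A Schur complement: this [s] minimises the form with [t] enlarged to [k]. *)
  have := psd (- (\sum_i x i) / k) (fun i => x i / z i).
  have -> : \sum_i z i * (x i / z i) = \sum_i x i.
    by apply: eq_bigr => i _; rewrite mulrCA divff ?mulr1 // gt_eqF.
  have -> : \sum_i \sum_j x i / z i * (x j / z j) * Q i j =
      \sum_i \sum_j x i * x j * P i j.
    apply: eq_bigr => i _; apply: eq_bigr => j _.
    by rewrite /P /c; have := z0 i; have := z0 j => ? ?; field; lra.
  set X := \sum_i x i; set G := \sum_i _ => h.
  have kG : 0 <= k * ((- X / k) ^+ 2) + 2 * (- X / k) * X + G.
    by apply: le_trans h _; rewrite !lerD2r ler_wpM2r ?sqr_ge0.
  have E1 : k * (k * ((- X / k) ^+ 2) + 2 * (- X / k) * X + G) = k * G - X ^+ 2.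
    by field; lra.
  by have := @mulr_ge0 _ k _ ltac:(lra) kG; rewrite E1; lra.
pose d i := 1 - (k * P i i - 1) / (k - 1).
have d0 i : 0 <= d i.
  rewrite /d subr_ge0 ler_pdivrMr ?subr_gt0 // mul1r.
  by have := Pii i; nra.
pose N i j := (k * P i j - 1) / (k - 1) + (if i == j then d i else 0).
have [i j|x|v hv] := @gram_of_psd R n N.
- rewrite /N /P /c symQ (mulrC (z i)) eq_sym.
  by case: eqP => // ->.
- have -> : \sum_i \sum_j x i * x j * N i j =
      (k * (\sum_i \sum_j x i * x j * P i j) - (\sum_i x i) ^+ 2) / (k - 1)
      + \sum_i d i * x i ^+ 2.
    rewrite expr2 big_distrlr !big_distrr -sumrB big_distrl -big_split.
    apply: eq_bigr => i _ /=.
    have -> : d i * x i ^+ 2 = \sum_j x i * x j * (if i == j then d i else 0).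
      rewrite (bigD1 i) //= eqxx big1 ?addr0; first by ring.
      by move=> j; rewrite eq_sym => /negPf ->; rewrite mulr0.
    rewrite big_distrr -sumrB big_distrl -big_split; apply: eq_bigr => j _ /=.
    by rewrite /N; set I := (if _ then _ else _); field; lra.
  rewrite addr_ge0 ?sumr_ge0 // => [|i _]; last by rewrite mulr_ge0 ?sqr_ge0.
  by rewrite divr_ge0 ?subr_ge0 ?psdP // ltW.
have dotE i j : dotv (\row_l v i l) (\row_l v j l) = N i j.
  by rewrite -hv; apply: eq_bigr => l _; rewrite !mxE.
have NE i j : i != j -> N i j = k / (k - 1) * P i j - (k - 1)^-1.
  by move=> /negPf ij; rewrite /N ij addr0; field; lra.
have kk : 0 <= k / (k - 1) by rewrite divr_ge0; lra.
have eN i j : e i j -> i != j by apply: contraTneq => ->; rewrite irr.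
exists (fun i => \row_l v i l); split=> [i|].
  by rewrite dotE /N eqxx /d addrCA subrr addr0.
move: sgP; rewrite /sign_pattern; case: kd => [h i j ij|h i j ij|[h h']].
- rewrite dotE NE ?eN // -[leRHS]add0r lerD2r.
  by rewrite mulr_ge0_le0 // h.
- by rewrite dotE NE ?eN // h // mulr0 add0r.
- split=> i j ij; first by rewrite dotE NE ?eN // h // mulr0 add0r.
  move=> eij; rewrite dotE NE // -[leLHS]add0r lerD2r.
  by rewrite mulr_ge0 // h'.
Qed.

Lemma feasible_ge1 e t : (0 < n)%N -> feasible e t (const_mx 1) -> 1 <= t.
Proof.
move=> n0 [z [Q [symQ sgQ wQ psd]]]; pose i := Ordinal n0.
have := psd (-1) (fun j => (j == i)%:R); have := wQ i; rewrite mxE.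
rewrite indicator_form.
under [\sum_i0 z i0 * _]eq_bigr do rewrite mulrC.
rewrite sum_indicatorM sqrrN expr1n; lra.
Qed.

(** It ensures that the [inf] in [bartheta] is over a nonempty set and not a default value. *)
Lemma coloring_exists e : irreflexive e ->
  exists k, 1 < k /\ exists v, is_coloring kd e k v.
Proof.
move=> irr; have [t ft] := feasible_exists (const_mx 1) irr.
exists (Num.max t 2); split; first by rewrite lt_max; apply/orP; right; lra.
by apply: (coloring_of_feasible irr ft); rewrite ?le_max ?lexx // lt_max; apply/orP; right; lra.
Qed.

Lemma le_bartheta e b : irreflexive e ->
  (forall k v, 1 < k -> is_coloring kd e k v -> b <= k) -> b <= bartheta kd e.
Proof.
move=> irr h; apply: lb_le_inf; first exact: coloring_exists.
by move=> k [k1 [v]]; exact: h.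
Qed.

Lemma bartheta_le_wtheta e : (0 < n)%N -> irreflexive e ->
  bartheta kd e <= wtheta e (const_mx 1).
Proof.
move=> n0 irr; apply: le_wtheta => // t ft.
have t1 := feasible_ge1 n0 ft.
(* The slack [eps] is there because [t] may equal 1, whereas a colouring parameter must exceed 1. *)
apply/ler_addgt0Pr => eps eps0; apply: ge_inf; first by exists 1 => k [/ltW].
have tk : 1 < t + eps by lra.
split=> //; apply: (coloring_of_feasible irr ft) => //; lra.
Qed.

(* A subgradient at [1] of the sublinear functional [wtheta] plays the role of
   the optimal orthonormal representation: its partial sums bound the theta
   number of every graph that agrees with [e] on the summation range. *)
Lemma bartheta_certificate e : (0 < n)%N -> irreflexive e ->
  exists b : 'I_n -> R, [/\ forall i, 0 <= b i <= 1,
    \sum_i b i = bartheta kd e &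
    forall (e' : rel 'I_n) (S : pred 'I_n), irreflexive e' ->
      (forall i j, S i -> S j -> e i j = e' i j) ->
      \sum_(i | S i) b i <= bartheta kd e'].
Proof.
move=> n0 irr.
have [b [b_le b_ge]] := hahn_banach_row (const_mx 1) (wtheta_sublinear irr).
have sub e' (S : pred 'I_n) : irreflexive e' ->
      (forall i j, S i -> S j -> e i j = e' i j) ->
      \sum_(i | S i) b i <= bartheta kd e'.
  move=> irr' ee'; apply: le_bartheta => // k v k1 col.
  have := b_le (\row_i (S i)%:R); have := wtheta_le (feasible_of_coloring k1 col ee').
  suff -> : \sum_i b i * (\row_i0 (S i0)%:R : 'rV[R]_n) 0 i = \sum_(i | S i) b i.
    by move=> h h'; exact: le_trans h' h.
  rewrite [RHS]big_mkcond; apply: eq_bigr => i _; rewrite mxE.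
  by case: (S i); rewrite ?mulr1 ?mulr0.
have single i (c : R) : \sum_j b j * (c *: delta_mx 0 i : 'rV[R]_n) 0 j = c * b i.
  rewrite (bigD1 i) //= !mxE !eqxx mulr1 big1 ?addr0 1?mulrC // => j ji.
  by rewrite !mxE (negPf ji) andbF !mulr0.
exists b; split=> // [i|].
  apply/andP; split.
    have := b_le (- delta_mx 0 i); have := wtheta_deltaN i irr.
    by rewrite -scaleN1r single; lra.
  have := b_le (1 *: delta_mx 0 i); have := wtheta_delta i irr.
  by rewrite single scale1r mul1r; lra.
(* One inequality is [sub] for [e] itself with all vertices; the other is the contact of [b] with
   [wtheta] at the all-ones weight. *)
apply/eqP; rewrite eq_le sub //=.
have := bartheta_le_wtheta n0 irr.
suff <- : \sum_i b i * (const_mx 1 : 'rV[R]_n) 0 i = \sum_i b i.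
  by move=> h; exact: le_trans h b_ge.
by apply: eq_bigr => i _; rewrite mxE mulr1.
Qed.

End WeightedTheta.

(** * Concentration *)

Lemma co_adj_irreflexive n (E : {set 'I_n * 'I_n}) : irreflexive (co_adj E).
Proof. by move=> i; rewrite /co_adj eqxx. Qed.

Lemma theta_ge1 kd n (E : {set 'I_n * 'I_n}) : 1 <= theta kd E.
Proof.
by apply: le_bartheta => [|k v /ltW //]; exact: co_adj_irreflexive.
Qed.

Lemma Pr_GnpE n p (P : {set 'I_n * 'I_n} -> Prop) :
  Pr_Gnp p P = bern_pr p (upper_pairs n) [set E | `[< P E >]].
Proof. by apply: eq_bigr => E _; rewrite inE; case: asboolP. Qed.

Lemma Pr_Gnp_eq0 n p (P : {set 'I_n * 'I_n} -> Prop) :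
  (forall E, ~ P E) -> Pr_Gnp p P = 0.
Proof. by move=> nP; apply: big1 => E _; rewrite asboolF ?mulr0. Qed.

Section VertexExposure.
Variables (n : nat).
Implicit Types (E : {set 'I_n * 'I_n}).

(* Coordinate [j] of the product space consists of the pairs [(i, j)], [i < j]. *)
Definition exposed (x : 'I_n * 'I_n) : nat := val x.2.

Lemma blocks_lt_exposed : blocks_lt (upper_pairs n) exposed n = upper_pairs n.
Proof. by apply/setP => x; rewrite inE ltn_ord andbT. Qed.

(** A possible edge lies in the block of its larger endpoint, so equal blocks at both [i] and [j]
    settle the pair in either order. *)
Lemma co_adj_agree E E' (i j : 'I_n) :
  E \subset upper_pairs n -> E' \subset upper_pairs n ->
  ~~ differ (upper_pairs n) exposed E E' i ->
  ~~ differ (upper_pairs n) exposed E E' j ->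
  co_adj E i j = co_adj E' i j.
Proof.
move=> EU E'U /negPn/eqP Ei /negPn/eqP Ej.
have agree k l : E :&: block (upper_pairs n) exposed (val l) =
    E' :&: block (upper_pairs n) exposed (val l) -> ((k, l) \in E) = ((k, l) \in E').
  move=> /setP/(_ (k, l)); rewrite !inE /= eqxx andbT.
  case: (boolP (k < l)%N) => kl; rewrite ?andbT // => _.
  apply/idP/idP => [/(subsetP EU)|/(subsetP E'U)];
  by rewrite inE /= (negPf kl).
by rewrite /co_adj /adj !agree.
Qed.

Lemma theta_two_levels kd (p a b : R) : (0 < n)%N -> 0 <= p <= 1 ->
  0 <= a -> a <= b -> 0 < b ->
  Pr_Gnp p (fun E => theta kd E <= a) * Pr_Gnp p (fun E => b <= theta kd E)
    <= expR (- ((b - a) ^+ 2 / (5 * b))).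
Proof.
move=> n0 p01 a0 ab b0.
set U := upper_pairs n.
pose A := [set E in powerset U | theta kd E <= a].
pose B := [set E in powerset U | b <= theta kd E].
have prE (P : {set 'I_n * 'I_n} -> bool) :
    Pr_Gnp p P = bern_pr p U [set E in powerset U | P E].
  rewrite Pr_GnpE; apply: eq_bern_mean => E EU.
  by rewrite !inE EU asboolb.
rewrite (prE (fun E => theta kd E <= a)) (prE (fun E => b <= theta kd E)).
have -> : (b - a) ^+ 2 / (5 * b) = ((b - a) / Num.sqrt b) ^+ 2 / 5.
  rewrite expr_div_n sqr_sqrtr ?ltW //; field; lra.
rewrite -[U]blocks_lt_exposed; apply: talagrand_two_sets => //.
- by rewrite divr_ge0 ?sqrtr_ge0 // subr_ge0.
- by apply/subsetP => E; rewrite inE => /andP[].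
rewrite blocks_lt_exposed => E; rewrite inE powersetE => /andP[EU bE].
have [beta [beta01 betaS sub]] := bartheta_certificate kd n0 (co_adj_irreflexive E).
set x := theta kd E in bE; rewrite -/(theta kd E) -/x in betaS.
have x0 : 0 < x by exact: lt_le_trans bE.
have sx0 : 0 < Num.sqrt x by rewrite sqrtr_gt0.
have sb0 : 0 < Num.sqrt b by rewrite sqrtr_gt0.
(* Talagrand's weights are indexed by [nat], so [beta] is extended by 0. *)
pose al (i : nat) := if insub i is Some j then beta j / Num.sqrt x else 0.
have alE (i : 'I_n) : al i = beta i / Num.sqrt x by rewrite /al valK.
exists al; first split.
- move=> i; rewrite /al; case: insubP => // j _ _.
  by rewrite divr_ge0 ?sqrtr_ge0 //; case/andP: (beta01 j).
- under eq_bigr do rewrite alE expr_div_n sqr_sqrtr ?(ltW x0) //.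
  rewrite -big_distrl /= ler_pdivrMr // mul1r -betaS; apply: ler_sum => i _.
  by case/andP: (beta01 i) => ? ?; rewrite expr2; nra.
move=> E'; rewrite inE powersetE => /andP[E'U E'a].
under eq_bigr do rewrite alE.
rewrite -big_distrl /=.
(* The graphs agree on the vertices whose blocks coincide, so the certificate has mass at most [a]
   there and at least [x - a] on the differing blocks. *)
have : \sum_(i < n | ~~ differ U exposed E E' i) beta i <= a.
  apply: le_trans E'a; apply: sub; first exact: co_adj_irreflexive.
  by move=> i j; exact: co_adj_agree.
have := betaS; rewrite (bigID (fun i : 'I_n => differ U exposed E E' i)) /=.
set s1 := \sum_(i < n | _) _; set s2 := \sum_(i < n | _) _ => s12 s2a.
apply: (@le_trans _ _ ((x - a) / Num.sqrt x)); last first.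
  by rewrite ler_pM2r ?invr_gt0 //; lra.
(* Written as [Num.sqrt x - a / Num.sqrt x], the bound is visibly increasing in [x], and
   [b <= x]. *)
rewrite -[in X in X - a](sqr_sqrtr (ltW b0)) -[in X in _ <= (X - a) / _](sqr_sqrtr (ltW x0)).
rewrite !mulrBl !expr2 !mulfK ?gt_eqF //.
have sbx : Num.sqrt b <= Num.sqrt x by rewrite ler_wsqrtr.
rewrite lerB // ler_wpM2l // lef_pV2 ?posrE //.
Qed.

End VertexExposure.

Theorem theorem1 :
  exists n0 : nat, (0 < n0)%N /\
  forall (n : nat), (n0 <= n)%N ->
  forall (p : R), 0 < p -> p <= 99 / 100 ->
  forall (kd : vkind) (m : R),
    @Pr_Gnp n p (fun E => theta kd E <= m) >= 1 / 2 ->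
    @Pr_Gnp n p (fun E => theta kd E >= m) >= 1 / 2 ->
    (forall xi : R, Num.max 10 (Num.sqrt m) <= xi ->
       @Pr_Gnp n p (fun E => theta kd E >= m + xi)
         <= 30 * expR (- (xi ^+ 2 / (5 * m + 10 * xi)))) /\
    (forall xi : R, 10 < xi ->
       @Pr_Gnp n p (fun E => theta kd E <= m - xi)
         <= 3 * expR (- (xi ^+ 2 / (10 * m)))).
Proof.
exists 1%N; split=> // n n0 p p0 p99 kd m med_le med_ge.
have p01 : 0 <= p <= 1 by apply/andP; split; lra.
have m1 : 1 <= m.
  rewrite leNgt; apply/negP => m1; move: med_le.
  rewrite Pr_Gnp_eq0; first by lra.
  by move=> E; have := theta_ge1 kd E; lra.
split=> xi.
  rewrite ge_max => /andP[xi10 _].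
  (* The median factor of at least 1/2 costs a constant 2, which is below 30, and
     [5 * (m + xi) <= 5 * m + 10 * xi]. *)
  have := @theta_two_levels n kd p m (m + xi) n0 p01 ltac:(lra) ltac:(lra) ltac:(lra).
  have -> : m + xi - m = xi by ring.
  set PB := Pr_Gnp p (fun E => is_true (m + xi <= _)).
  have : expR (- (xi ^+ 2 / (5 * (m + xi)))) <= expR (- (xi ^+ 2 / (5 * m + 10 * xi))).
    by rewrite ler_expR lerN2 ler_wpM2l ?sqr_ge0 // lef_pV2 ?posrE; lra.
  have : 0 <= PB by rewrite /PB Pr_GnpE bern_pr_ge0.
  by have := expR_gt0 (- (xi ^+ 2 / (5 * m + 10 * xi))); nra.
move=> xi10.
(* A negative level gives an empty event because theta is at least 1; otherwise the median is the
   upper level. *)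
have [mxi|mxi] := ltP (m - xi) 0.
  rewrite Pr_Gnp_eq0; first by rewrite mulr_ge0 ?expR_ge0.
  by move=> E; have := theta_ge1 kd E; lra.
have := @theta_two_levels n kd p (m - xi) m n0 p01 mxi ltac:(lra) ltac:(lra).
have -> : m - (m - xi) = xi by ring.
set PA := Pr_Gnp p (fun E => is_true (_ <= m - xi)).
have : expR (- (xi ^+ 2 / (5 * m))) <= expR (- (xi ^+ 2 / (10 * m))).
  by rewrite ler_expR lerN2 ler_wpM2l ?sqr_ge0 // lef_pV2 ?posrE; lra.
have : 0 <= PA by rewrite /PA Pr_GnpE bern_pr_ge0.
by have := expR_gt0 (- (xi ^+ 2 / (10 * m))); nra.
Qed.
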